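(* Let $\mathbf{x}\subseteq\{1,\dots,L\}$ be a configuration with $K=|\mathbf{x}|$ particles and let $N\in\{0,1,\dots,L\}$ be a particle number. Let $H^K_N := \hat{\mathbf{1}}_N\, H(q,q^{1-\frac{2K}{L}},1)\,\hat{\mathbf{1}}_N$ be the generator of the globally conditioned ASEP with $N$ particles and periodic boundary conditions and driving strength $s=-\frac{2K}{L}\ln q$. Let $|\mu^N_{\mathbf{x}}\rangle := \hat{\mathbf{1}}_N|\mu_{\mathbf{x}}\rangle$ be the unnormalized shock/antishock measure restricted to $N$ particles, and for $t\ge 0$ let $$|\mu^N_{\mathbf{x}}(t)\rangle := \mathrm{e}^{-H^K_N t}\,|\mu^N_{\mathbf{x}}\rangle .$$ Then for all $t\ge 0$ $$|\mu^N_{\mathbf{x}}(t)\rangle = \sum_{\mathbf{y}\in\Omega_K} P^N(\mathbf{y},t|\mathbf{x},0)\,|\mu^N_{\mathbf{y}}\rangle ,$$ where $P^N(\mathbf{y},t|\mathbf{x},0) := \langle \mathbf{y}|\,\mathrm{e}^{-H^N_K t}\,|\mathbf{x}\rangle$ with $H^N_K := \hat{\mathbf{1}}_K\, H(q,q^{1-\frac{2N}{L}},1)\,\hat{\mathbf{1}}_K$ is the conditioned $K$-particle transition probability from $\mathbf{x}$ to $\mathbf{y}$ at time $t$ with driving strength $s'=-\frac{2N}{L}\ln q$.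
   Context: Parameters: an integer $L\ge 2$ (number of sites of a ring), an asymmetry $q>0$, $q\neq 1$, a time scale $w\neq 0$, and a fugacity $z>0$. Configurations: $\eta=(\eta(1),\dots,\eta(L))\in\Omega=\{0,1\}^L$ is identified with the set $\mathbf{x}=\{k:\eta(k)=1\}$ of occupied sites, whose elements are written $x_1<\dots<x_K$ with $K=|\mathbf{x}|$. $\Omega_N$ is the set of configurations with exactly $N$ particles. To $\eta$ one assigns the basis vector $|\eta\rangle=|\eta(1))\otimes\cdots\otimes|\eta(L))$ of $(\mathbb{C}^2)^{\otimes L}$, where $|0)=(1,0)^T$ and $|1)=(0,1)^T$; $\langle\eta|$ is its transpose. $|\mathbf{x}\rangle$ denotes the same vector as $|\eta\rangle$ when $\eta$ and $\mathbf{x}$ are identified. The projector on $N$ particles is $\hat{\mathbf{1}}_N=\sum_{\eta\in\Omega_N}|\eta\rangle\langle\eta|$. One-site matrices: $\sigma^+=\begin{pmatrix}0&1\\0&0\end{pmatrix}$, $\sigma^-=\begin{pmatrix}0&0\\1&0\end{pmatrix}$, $\hat n=\begin{pmatrix}0&0\\0&1\end{pmatrix}$, $\hat\upsilon=\begin{pmatrix}1&0\\0&0\end{pmatrix}$; for a one-site matrix $u$, $u_k$ denotes $u$ acting on the $k$-th tensor factor and as the identity on the others. Weighted generator with periodic boundary conditions (for $\alpha,\beta>0$): $$H(q,\alpha,\beta)=\sum_{k=1}^{L-1}h_{k,k+1}(q,\alpha)+h_{L,1}(q,\alpha,\beta),$$ $$h_{k,k+1}(q,\alpha)=-w\left[\alpha\,\sigma^+_k\sigma^-_{k+1}-q\,\hat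 n_k\hat\upsilon_{k+1}+\alpha^{-1}\sigma^-_k\sigma^+_{k+1}-q^{-1}\hat\upsilon_k\hat n_{k+1}\right],$$ $$h_{L,1}(q,\alpha,\beta)=-w\left[\alpha\beta\,\sigma^+_L\sigma^-_{1}-q\,\hat n_L\hat\upsilon_{1}+(\alpha\beta)^{-1}\sigma^-_L\sigma^+_{1}-q^{-1}\hat\upsilon_L\hat n_{1}\right].$$ Here $\alpha=q\,\mathrm{e}^{s}$ with driving strength $s$ and $\beta=\mathrm{e}^{\bar s}$ with boundary driving strength $\bar s$. Shock/antishock measure: with $|z\rangle:=\left((1,z)^T\right)^{\otimes L}$, for a set $\mathbf{x}=\{x_1,\dots,x_K\}$, $$|\mu_{\mathbf{x}}\rangle=\prod_{j=1}^K\left[z^{-1}\,q^{\frac{2}{L}\sum_{l=1}^L(x_j-l)\hat n_l-\sum_{i=1}^{x_j-1}\hat n_i+\sum_{i=x_j+1}^{L}\hat n_i}\;\hat n_{x_j}\right]|z\rangle .$$ (All operators $\hat n_l$ are diagonal, so the product is unambiguous.) *)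

(* Defs.v *)
(* Written with MathComp, MathComp-Analysis and the complex numbers R[i] of
   mathcomp-real-closed. *)
From HB Require Import structures.
From mathcomp Require Import all_boot all_order all_algebra complex.
From mathcomp Require Import all_classical all_reals all_analysis.

Set Implicit Arguments.
Unset Strict Implicit.
Unset Printing Implicit Defensive.

Import Order.TTheory GRing.Theory Num.Theory.
Import numFieldNormedType.Exports.

Local Open Scope classical_set_scope.
Local Open Scope ring_scope.
Local Open Scope complex_scope.

(* The limit is taken in the (entrywise) topology of the space of matrices. *)
Definition mexp (F : numFieldType) (n : nat) (A : 'M[F]_n) : 'M[F]_n :=
  lim (series (fun k : nat => (k`!%:R)^-1 *: A ^+ k) @ \oo).

(* Sites are numbered from 0 to L - 1 instead of 1 to L; only the order of the
   sites and differences of positions ever matter.  A configuration is the set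
   of its occupied sites. *)
Notation config L := {set 'I_L}.

Definition occ (L : nat) (x : config L) (k : 'I_L) : 'I_2 := inord (k \in x).

Section Operators.
Variables (R : realType) (L : nat).

(* (C^2)^{(x) L} in coordinates: the canonical basis is indexed by the
   configurations, listed by enum_val. *)
Notation vect := 'cV[R[i]]_#|{: config L}|.
Notation oper := 'M[R[i]]_#|{: config L}|.

(* u_1 (x) ... (x) u_L, for one-site matrices and for one-site vectors *)
Definition tensop (u : 'I_L -> 'M[R[i]]_2) : oper :=
  \matrix_(i, j) \prod_(k < L) u k (occ (enum_val i) k) (occ (enum_val j) k).

Definition tensvec (v : 'I_L -> 'cV[R[i]]_2) : vect :=
  \col_i \prod_(k < L) v k (occ (enum_val i) k) 0.

Definition ket (x : config L) : vect := tensvec (fun k => delta_mx (occ x k) 0).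

Definition bra (x : config L) : 'rV[R[i]]_#|{: config L}| := (ket x)^T.

Definition projN (N : nat) : oper :=
  \sum_(x : config L | #|x| == N) ket x *m bra x.

Definition at_site (u : 'M[R[i]]_2) (k : 'I_L) : oper :=
  tensop (fun l => if l == k then u else 1%:M).

Definition sp : 'I_L -> oper := at_site (delta_mx 0 1).
Definition sm : 'I_L -> oper := at_site (delta_mx 1 0).
Definition nhat : 'I_L -> oper := at_site (delta_mx 1 1).
Definition vhat : 'I_L -> oper := at_site (delta_mx 0 0).

Definition bond (w q a : R) (k k' : 'I_L) : oper :=
  - w%:C *: (a%:C *: (sp k *m sm k') - q%:C *: (nhat k *m vhat k')
             + (a^-1)%:C *: (sm k *m sp k') - (q^-1)%:C *: (vhat k *m nhat k')).

(* ordS is the cyclic successor; the second sum consists of the single bond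
   from the last site to the first one. *)
Definition Hgen (w q alpha beta : R) : oper :=
  \sum_(k < L | (k.+1 < L)%N) bond w q alpha k (ordS k)
  + \sum_(k < L | k.+1 == L) bond w q (alpha * beta) k (ordS k).

(* q ^ D for an operator D *)
Definition qpow (q : R) (D : oper) : oper := mexp ((ln q)%:C *: D).

Definition shock_exponent (x : 'I_L) : oper :=
  (2 / L%:R)%:C *: (\sum_(l < L) (x%:R - l%:R)%:C *: nhat l)
  - \sum_(i < L | (i < x)%N) nhat i + \sum_(i < L | (x < i)%N) nhat i.

Definition zket (z : R) : vect :=
  tensvec (fun=> \col_b (if b == 0 then 1 else z%:C)).

Definition shock (q z : R) (x : config L) : vect :=
  (\prod_(k in x) ((z^-1)%:C *: (qpow q (shock_exponent k) *m nhat k)))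
    *m zket z.

Definition muN (q z : R) (N : nat) (x : config L) : vect :=
  projN N *m shock q z x.

(* The generator restricted to N particles, at driving strength
   s = - (2 K / L) ln q: here alpha = q e^s = q ^ (1 - 2 K / L). *)
Definition HNK (w q : R) (N K : nat) : oper :=
  projN N *m Hgen w q (q `^ (1 - 2 * K%:R / L%:R)) 1 *m projN N.

Definition muN_at (w q z : R) (N : nat) (x : config L) (t : R) : vect :=
  mexp (- (t%:C *: HNK w q N #|x|)) *m muN q z N x.

Definition trans_prob (w q : R) (N K : nat) (y x : config L) (t : R) : R[i] :=
  (bra y *m mexp (- (t%:C *: HNK w q K N)) *m ket x) 0 0.

End Operators.

(* Main.v *)
(* Let M be the matrix whose column x is the measure mu^N_x.  The theorem says
   that exp(-t H^K_N) M = M exp(-t H^N_K), which follows from the duality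
   H^K_N M = M H^N_K by comparing the exponential series term by term.

   On Omega_N x Omega_K the entries of M are
     M(y, x) = z^(N-K) [x subset y] q^(sum_{k in x, l in y} e(k, l)),
   where e(k, l) = 2 (k - l) / L + sgn(l - k) is antisymmetric and depends only
   on k - l modulo L, so all bonds of the ring play the same role.  The duality
   does not hold bond by bond: for the bond (a, b) the two sides, without the
   factor -w, differ by
     (q - q^-1) M(y, x) ((y_b - x_b) - (y_a - x_a)),
   which telescopes to zero around the ring. *)

Require Import Defs.
From HB Require Import structures.
From mathcomp Require Import all_boot all_order all_algebra complex.
From mathcomp Require Import all_classical all_reals all_analysis.
From mathcomp Require Import zify ring.

Set Implicit Arguments.
Unset Strict Implicit.
Unset Printing Implicit Defensive.

Import Order.TTheory GRing.Theory Num.Theory.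
Import numFieldNormedType.Exports.

Local Open Scope classical_set_scope.
Local Open Scope ring_scope.
Local Open Scope complex_scope.

(** * Convergence and intertwining of matrix exponentials *)

Section MatrixExponential.
Variable R : realType.
Local Notation C := (R[i] : numFieldType).

Lemma cvg_real_complex (u : nat -> R) (l : R) :
  u @ \oo --> l -> (fun k => (u k)%:C : C) @ \oo --> (l%:C : C).
Proof.
move=> /cvgrPdist_lt ul; apply/cvgrPdist_lt => /= -[e e'].
(* A positive element of [R[i]] has zero imaginary part, so the radius is real. *)
rewrite ltcE /= => /andP[/eqP-> e0].
near=> k.
rewrite -rmorphB normc_def /= expr0n /= addr0 sqrtr_sqr ltcR.
by near: k; exact: ul.
Unshelve. all: by end_near. Qed.

Lemma cvg_mx (F : numFieldType) (m n : nat) (u : nat -> 'M[F]_(m, n))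
    (l : 'M[F]_(m, n)) :
  (forall i j, (fun k => u k i j) @ \oo --> l i j) -> u @ \oo --> l.
Proof.
move=> ul; apply/cvg_ballP => e e0.
near=> k; split=> //; near: k.
apply: filter_forall => i; apply: filter_forall => j.
by move/cvg_ballP : (ul i j) => /(_ _ e0).
Unshelve. all: by end_near. Qed.

(** Real and imaginary parts are both dominated by the modulus, which reduces the claim to the real
    comparison test. *)
Lemma is_cvg_series_complex (u : nat -> C) (v : nat -> R) :
  (forall k, `|u k| <= (v k)%:C) -> cvgn (series v) -> cvgn (series u).
Proof.
move=> uv cv.
have cvg_dom (f : nat -> R) : (forall k, `|f k| <= v k) -> cvgn (series f).
  move=> fv; apply: normed_cvg; apply: (series_le_cvg _ _ fv cv) => k.
    exact: normr_ge0.
  exact: le_trans (normr_ge0 (f k)) (fv k).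
have cRe : cvgn (series (fun k => complex.Re (u k))).
  apply: cvg_dom => k; rewrite -lecR; apply: le_trans (uv k).
  exact: normc_ge_Re.
have cIm : cvgn (series (fun k => complex.Im (u k))).
  apply: cvg_dom => k; rewrite -lecR; apply: le_trans (uv k).
  rewrite normc_def lecR -sqrtr_sqr; apply: ler_wsqrtr.
  by rewrite lerDr sqr_ge0.
have -> : series u = fun k => (series (fun k => complex.Re (u k)) k)%:C
                     + 'i * (series (fun k => complex.Im (u k)) k)%:C.
  apply/funext => k; rewrite /series /= !rmorph_sum mulr_sumr -big_split /=.
  by apply: eq_bigr => j _; rewrite {1}[u j]complexE.
apply/cvg_ex; eexists; apply: cvgD; first exact: cvg_real_complex cRe.
by apply: cvgM; [exact: cvg_cst|exact: cvg_real_complex cIm].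
Qed.

Definition mexp_term (n : nat) (A : 'M[C]_n) (k : nat) : 'M[C]_n :=
  (k`!%:R)^-1 *: A ^+ k.

Lemma mx_exp_bound (n : nat) (A : 'M[C]_n) :
  exists2 c : R, 0 <= c & forall k i j, `|(A ^+ k) i j| <= (c ^+ k)%:C.
Proof.
pose a p := complex.Re `|A p.1 p.2|.
have Aa p : 0 <= a p /\ `|A p.1 p.2| = (a p)%:C.
  by rewrite /a normc_def /=; split=> //; exact: sqrtr_ge0.
pose b := \sum_p a p.
have b0 : 0 <= b by apply: sumr_ge0 => p _; case: (Aa p).
have Ab i j : `|A i j| <= b%:C.
  have [_ /= ->] := Aa (i, j); rewrite lecR /b (bigD1 (i, j)) //= lerDl.
  by apply: sumr_ge0 => p _; case: (Aa p).
(* [b] bounds every entry of [A], and an entry of a matrix product is a sum of [n] terms: each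
   further power costs a factor [n * b]. *)
exists (n%:R * b); first by rewrite mulr_ge0.
elim=> [i j|k IH i j].
  by rewrite !expr0 mxE rmorph1; case: (i == j); rewrite ?normr1 ?normr0 ?ler01.
rewrite exprSr [(_ * _)%R]/(_ *m _) mxE.
apply: le_trans (ler_norm_sum _ _ _) _.
apply: (@le_trans _ _ (\sum_(l < n) ((n%:R * b) ^+ k * b)%:C)).
  by apply: ler_sum => l _; rewrite normrM rmorphM ler_pM.
by rewrite sumr_const card_ord exprSr -rmorphMn /= -mulrnAr mulr_natl.
Qed.

(** [mexp] is a bare [lim], informative only once convergence is known. Entrywise the series is
    dominated by the exponential series of the constant from [mx_exp_bound]. *)
Lemma cvg_mexp (n : nat) (A : 'M[C]_n) :
  series (mexp_term A) @ \oo --> mexp A.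
Proof.
have [c c0 Ac] := mx_exp_bound A.
have cvg_entry i j : cvgn (series (fun k => mexp_term A k i j)).
  apply: (is_cvg_series_complex (v := exp_coeff c)).
    move=> k; rewrite mxE normrM exp_coeffE rmorphM ler_pM //.
      by rewrite normfV normr_nat fmorphV rmorph_nat.
    exact: Ac.
  exact: is_cvg_series_exp_coeff.
suff : cvgn (series (mexp_term A)) by [].
apply/cvg_ex; exists (\matrix_(i, j) limn (series (fun k => mexp_term A k i j))).
apply: cvg_mx => i j; rewrite mxE.
suff -> : (fun k => series (mexp_term A) k i j)
          = series (fun k => mexp_term A k i j) by exact: cvg_entry.
by apply/funext => k; rewrite /series /= summxE.
Qed.

Lemma cvg_mexp_entry (n : nat) (A : 'M[C]_n) (i j : 'I_n) :
  (fun k => series (mexp_term A) k i j) @ \oo --> mexp A i j.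
Proof.
apply: (@continuous_cvg _ _ _ _ _ (series (mexp_term A))
          (fun M : 'M[C]_n => M i j)); last exact: cvg_mexp.
exact: coord_continuous.
Qed.

Lemma cvg_sum_seq (I : finType) (u : I -> nat -> C) (l : I -> C) :
  (forall i, u i @ \oo --> l i) ->
  (fun k => \sum_i u i k) @ \oo --> \sum_i l i.
Proof. by move=> ul; apply: cvg_big => //; exact: add_continuous. Qed.

(** The relation passes to powers and partial sums; then one sequence of entries has both sides as
    limits. [M] may be rectangular, so that a column vector also qualifies. *)
Lemma mexp_intertwine (n m : nat) (A : 'M[C]_n) (B : 'M[C]_m)
    (M : 'M[C]_(n, m)) :
  A *m M = M *m B -> mexp A *m M = M *m mexp B.
Proof.
move=> AMB.
have pow k : A ^+ k *m M = M *m B ^+ k.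
  elim: k => [|k IH].
    by rewrite !expr0; exact: etrans (mul1mx M) (esym (mulmx1 M)).
  rewrite !exprS -[(A * _)%R]/(A *m _) -[(B * _)%R]/(B *m _).
  by rewrite -mulmxA IH mulmxA AMB -mulmxA.
have ser k : series (mexp_term A) k *m M = M *m series (mexp_term B) k.
  rewrite /series /= mulmx_suml mulmx_sumr; apply: eq_bigr => j _.
  by rewrite -scalemxAl pow scalemxAr.
apply/matrixP => i j; rewrite !mxE.
have cl : (fun k => (series (mexp_term A) k *m M) i j) @ \oo
          --> \sum_l mexp A i l * M l j.
  under eq_fun do rewrite mxE.
  apply: cvg_sum_seq => l; apply: cvgM; last exact: cvg_cst.
  exact: cvg_mexp_entry.
have cr : (fun k => (series (mexp_term A) k *m M) i j) @ \oo
          --> \sum_l M i l * mexp B l j.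
  under eq_fun do rewrite ser mxE.
  apply: cvg_sum_seq => l; apply: cvgM; first exact: cvg_cst.
  exact: cvg_mexp_entry.
exact: (cvg_unique (@norm_hausdorff _ _) cl cr).
Qed.

Lemma mexp_eigen (n : nat) (A : 'M[C]_n) (c : R) (v : 'cV[C]_n) :
  A *m v = c%:C *: v -> mexp A *m v = (expR c)%:C *: v.
Proof.
move=> Av.
(* An eigenvector intertwines [A] with the 1 x 1 matrix of its eigenvalue, whose exponential is then
   compared with [expR]. *)
have Bv : A *m v = v *m (c%:C)%:M by rewrite Av mul_mx_scalar.
rewrite (mexp_intertwine Bv) [mexp _]mx11_scalar mul_mx_scalar; congr (_ *: _).
set B := (X in mexp X).
have c1 := @cvg_mexp_entry _ B 0 0.
have c2 : (fun k => series (mexp_term B) k 0 0) @ \oo --> ((expR c)%:C : C).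
  have -> : (fun k => series (mexp_term B) k 0 0)
            = fun k => (series (exp_coeff c) k)%:C.
    apply/funext => k; rewrite /series /= summxE rmorph_sum.
    apply: eq_bigr => j _; rewrite exp_coeffE mxE -rmorphXn /= mxE eqxx mulr1n.
    by rewrite rmorphM fmorphV rmorph_nat rmorphXn.
  exact: cvg_real_complex (is_cvg_series_exp_coeff c).
exact: (cvg_unique (@norm_hausdorff _ _) c1 c2).
Qed.

End MatrixExponential.

(** * Tensor operators in the basis of configurations *)

Section Tensor.
Variables (R : realType) (L : nat).
Implicit Types (x y : config L) (k l a b : 'I_L).
Local Notation ket := (@ket R L).
Local Notation bra := (@bra R L).

Lemma occE x k : occ x k = if k \in x then 1 else 0.
Proof. by apply/val_inj; rewrite /occ; case: (k \in x); rewrite /= inordK. Qed.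

Lemma occ_eq1 x k : (occ x k == 1) = (k \in x).
Proof. by rewrite occE; case: ifP. Qed.

Lemma occ_eq0 x k : (occ x k == 0) = (k \notin x).
Proof. by rewrite occE; case: ifP. Qed.

Definition config_of (f : {ffun 'I_L -> 'I_2}) : config L := [set k | f k == 1].

Lemma config_ofK f k : occ (config_of f) k = f k.
Proof.
rewrite occE inE; case: eqP => [->//|f1]; apply/val_inj => /=.
by case: (f k) f1 => -[|[|]] //= i [] ; apply/val_inj.
Qed.

Lemma occ_inj x y : (forall k, occ x k = occ y k) -> x = y.
Proof. by move=> xy; apply/setP => k; rewrite -!occ_eq1 xy. Qed.

Lemma config_of_bij : bijective config_of.
Proof.
exists (fun x => [ffun k => occ x k]) => [f|x].
  by apply/ffunP => k; rewrite ffunE config_ofK.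
by apply: occ_inj => k; rewrite config_ofK ffunE.
Qed.

(** Distributing the product over sites of the one-site sums yields a sum over functions
    ['I_L -> 'I_2], which [config_of] matches with the summation index of the matrix product. *)
Lemma tensop_tensvec (u : 'I_L -> 'M[R[i]]_2) (v : 'I_L -> 'cV[R[i]]_2) :
  tensop u *m tensvec v = tensvec (fun k => u k *m v k).
Proof.
apply/matrixP => i j; rewrite !mxE.
under [RHS]eq_bigr do rewrite mxE.
rewrite bigA_distr_bigA /=.
rewrite (reindex (@enum_rank (config L))) /=; last first.
  exact: onW_bij (@enum_rank_bij _).
rewrite (reindex config_of) /=; last exact: onW_bij config_of_bij.
apply: eq_bigr => f _; rewrite !mxE enum_rankK -big_split /=.
by apply: eq_bigr => k _; rewrite config_ofK.
Qed.

Lemma ketE x : ket x = delta_mx (enum_rank x) 0.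
Proof.
apply/matrixP => i j; rewrite !mxE ord1 eqxx andbT.
have [->|ix] := eqVneq i (enum_rank x).
  by rewrite enum_rankK big1 // => k _; rewrite mxE !eqxx.
have /existsP[k kx] : [exists k, occ (enum_val i) k != occ x k].
  rewrite -negb_forall; apply: contra ix => /forallP xi; apply/eqP.
  apply: enum_val_inj; rewrite enum_rankK; apply: occ_inj => k.
  exact/eqP.
by rewrite (bigD1 k) //= mxE (negPf kx) mul0r.
Qed.

Lemma bra_mul n x (A : 'M[R[i]]_(_, n)) : bra x *m A = row (enum_rank x) A.
Proof. by rewrite /bra ketE trmx_delta -rowE. Qed.

Lemma bra_mulE x (v : 'cV[R[i]]_ _) : (bra x *m v) 0 0 = v (enum_rank x) 0.
Proof. by rewrite bra_mul mxE. Qed.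

Lemma mul_ket n (A : 'M[R[i]]_(n, _)) x : A *m ket x = col (enum_rank x) A.
Proof. by rewrite ketE -colE. Qed.

Lemma bra_ket x y : (bra x *m ket y) 0 0 = (x == y)%:R.
Proof.
by rewrite bra_mulE ketE mxE eqxx andbT (inj_eq enum_rank_inj).
Qed.

Lemma matrix_ketP (n : nat) (A B : 'M[R[i]]_(n, #|{: config L}|)) :
  (forall x, A *m ket x = B *m ket x) -> A = B.
Proof.
move=> AB; apply/matrixP => i j.
have := AB (enum_val j); rewrite !mul_ket enum_valK => /matrixP/(_ i 0).
by rewrite !mxE.
Qed.

Lemma matrix_braP (n : nat) (A B : 'M[R[i]]_(#|{: config L}|, n)) :
  (forall x, bra x *m A = bra x *m B) -> A = B.
Proof.
move=> AB; apply/matrixP => i j.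
have := AB (enum_val i); rewrite !bra_mul enum_valK => /matrixP/(_ 0 j).
by rewrite !mxE.
Qed.

Definition set_site x k (c : 'I_2) : config L :=
  if c == 1 then k |: x else x :\ k.

Lemma occ_set_site x k (c : 'I_2) l :
  occ (set_site x k c) l = if l == k then c else occ x l.
Proof.
rewrite /set_site; case: eqP => [->|c1].
  by rewrite !occE !inE; case: (l == k).
have -> : c = 0 by apply/val_inj; case: c c1 => -[|[|]] //= i []; apply/val_inj.
by rewrite !occE !inE; case: (l == k).
Qed.

Lemma at_site_ket (b c : 'I_2) k x :
  at_site (delta_mx b c) k *m ket x = (c == occ x k)%:R *: ket (set_site x k b).
Proof.
rewrite /at_site /Defs.ket tensop_tensvec.
have [cx|cx] := eqVneq; last first.
  (* On a mismatch the factor at site [k] is zero, hence so is the whole product. *)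
  apply/matrixP => i j; rewrite scale0r !mxE (bigD1 k) //= eqxx.
  by rewrite mul_delta_mx_0 // mxE mul0r.
rewrite scale1r; congr tensvec; apply/funext => l; rewrite occ_set_site.
case: eqP => [->|_]; last by rewrite mul1mx.
by rewrite -cx mul_delta_mx.
Qed.

Lemma sp_ket k x : sp R k *m ket x = (k \in x)%:R *: ket (x :\ k).
Proof. by rewrite at_site_ket eq_sym occ_eq1. Qed.

Lemma sm_ket k x : sm R k *m ket x = (k \notin x)%:R *: ket (k |: x).
Proof. by rewrite at_site_ket eq_sym occ_eq0. Qed.

Lemma nhat_ket k x : nhat R k *m ket x = (k \in x)%:R *: ket x.
Proof.
rewrite at_site_ket eq_sym occ_eq1 /set_site eqxx.
case: (boolP (k \in x)) => [kx|]; rewrite ?scale0r //.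
by rewrite (finset.setUidPr _) ?finset.sub1set.
Qed.

Lemma vhat_ket k x : vhat R k *m ket x = (k \notin x)%:R *: ket x.
Proof.
rewrite at_site_ket eq_sym occ_eq0 /set_site /=.
case: (boolP (k \in x)) => [|kx]; rewrite ?scale0r //; congr (_ *: ket _).
by apply/setP => l; rewrite !inE; case: eqP => // ->; rewrite (negPf kx).
Qed.

(** Through transposes, the action of the site operators on bras follows from their action on
    kets. *)
Lemma tr_at_site (u : 'M[R[i]]_2) k : (at_site u k)^T = at_site u^T k.
Proof.
apply/matrixP => i j; rewrite !mxE; apply: eq_bigr => l _.
by case: eqP => _; rewrite !mxE // eq_sym.
Qed.

Lemma tr_sp k : (sp R k)^T = sm R k.
Proof. by rewrite tr_at_site trmx_delta. Qed.

Lemma tr_sm k : (sm R k)^T = sp R k.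
Proof. by rewrite tr_at_site trmx_delta. Qed.

Lemma tr_nhat k : (nhat R k)^T = nhat R k.
Proof. by rewrite tr_at_site trmx_delta. Qed.

Lemma tr_vhat k : (vhat R k)^T = vhat R k.
Proof. by rewrite tr_at_site trmx_delta. Qed.

(** * Action of a single bond *)

Definition hop x a b : config L := (b |: x) :\ a.

Lemma spsm_ket a b x : a != b ->
  sp R a *m sm R b *m ket x = ((a \in x) && (b \notin x))%:R *: ket (hop x a b).
Proof.
move=> ab; rewrite -mulmxA sm_ket -scalemxAr sp_ket scalerA !inE (negPf ab) /=.
by rewrite mulrC -natrM mulnb.
Qed.

Lemma nv_ket a b x :
  nhat R a *m vhat R b *m ket x = ((a \in x) && (b \notin x))%:R *: ket x.
Proof.
by rewrite -mulmxA vhat_ket -scalemxAr nhat_ket scalerA mulrC -natrM mulnb.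
Qed.

Lemma smsp_ket a b x : a != b ->
  sm R a *m sp R b *m ket x = ((b \in x) && (a \notin x))%:R *: ket (hop x b a).
Proof.
move=> ab; rewrite -mulmxA sp_ket -scalemxAr sm_ket scalerA !inE (negPf ab) /=.
rewrite -natrM mulnb; congr (_ *: ket _); apply/setP => k; rewrite !inE.
by case: eqP => // ->; rewrite (negPf ab).
Qed.

Lemma vn_ket a b x :
  vhat R a *m nhat R b *m ket x = ((b \in x) && (a \notin x))%:R *: ket x.
Proof. by rewrite -mulmxA nhat_ket -scalemxAr vhat_ket scalerA -natrM mulnb. Qed.

(* The linear extension of phi, evaluated at the image of |x> under the bond. *)
Definition bond_action (w q r : R) (phi : config L -> R) a b x : R :=
  - w * (((a \in x) && (b \notin x))%:R * (r * phi (hop x a b) - q * phi x)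
       + ((b \in x) && (a \notin x))%:R * (r^-1 * phi (hop x b a) - q^-1 * phi x)).

Lemma mulmx4_entry (n : nat) (c r1 r2 r3 r4 d1 d2 d3 d4 : R[i])
    (A B C D : 'M[R[i]]_n) (u : 'rV[R[i]]_n) (v : 'cV[R[i]]_n) :
  (u *m (A *m v)) 0 0 = d1 -> (u *m (B *m v)) 0 0 = d2 ->
  (u *m (C *m v)) 0 0 = d3 -> (u *m (D *m v)) 0 0 = d4 ->
  (u *m (c *: (r1 *: A - r2 *: B + r3 *: C - r4 *: D)) *m v) 0 0
  = c * (r1 * d1 - r2 * d2 + r3 * d3 - r4 * d4).
Proof.
rewrite -mulmxA -scalemxAl -scalemxAr mulmxBl mulmxDl mulmxBl -!scalemxAl.
rewrite mulmxBr mulmxDr mulmxBr -!scalemxAr.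
move: (u *m (A *m v)) (u *m (B *m v)) (u *m (C *m v)) (u *m (D *m v)).
by move=> M1 M2 M3 M4 <- <- <- <-; rewrite !mxE.
Qed.

Lemma bond_entry (w q r : R) (c1 c2 c3 c4 : R) a b
    (u : 'rV[R[i]]_#|{: config L}|) (v : 'cV[R[i]]_#|{: config L}|) :
  (u *m (sp R a *m sm R b *m v)) 0 0 = c1%:C ->
  (u *m (nhat R a *m vhat R b *m v)) 0 0 = c2%:C ->
  (u *m (sm R a *m sp R b *m v)) 0 0 = c3%:C ->
  (u *m (vhat R a *m nhat R b *m v)) 0 0 = c4%:C ->
  (u *m bond w q r a b *m v) 0 0
  = (- w * (r * c1 - q * c2 + r^-1 * c3 - q^-1 * c4))%:C.
Proof.
move=> e1 e2 e3 e4; rewrite (mulmx4_entry _ _ _ _ _ e1 e2 e3 e4).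
by rewrite !(rmorphM, rmorphD, rmorphN).
Qed.

(** Only the real values of [u] on kets enter, so the duality becomes a computation in [R] with
    functions of configurations. *)
Lemma bond_ket_entry (w q r : R) (phi : config L -> R) a b x
    (u : 'rV[R[i]]_#|{: config L}|) : a != b ->
  (forall y, (u *m ket y) 0 0 = (phi y)%:C) ->
  (u *m bond w q r a b *m ket x) 0 0 = (bond_action w q r phi a b x)%:C.
Proof.
move=> ab uphi.
have scaled (M : 'M[R[i]]_#|{: config L}|) (c : bool) y :
    M *m ket x = c%:R *: ket y -> (u *m (M *m ket x)) 0 0 = (c%:R * phi y)%:C.
  by move=> ->; rewrite -scalemxAr [LHS]mxE uphi rmorphM rmorph_nat.
rewrite (bond_entry w q r (scaled _ _ _ (spsm_ket x ab))
          (scaled _ _ _ (nv_ket a b x)) (scaled _ _ _ (smsp_ket x ab))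
          (scaled _ _ _ (vn_ket a b x))).
by congr (_%:C); rewrite /bond_action; ring.
Qed.

(** Transposition exchanges the two hopping terms, which replaces [r] by its inverse, and fixes the
    two diagonal terms. *)
Lemma bra_bond_entry (w q r : R) (phi : config L -> R) a b x
    (v : 'cV[R[i]]_#|{: config L}|) : a != b ->
  (forall y, (bra y *m v) 0 0 = (phi y)%:C) ->
  (bra x *m bond w q r a b *m v) 0 0 = (bond_action w q r^-1 phi a b x)%:C.
Proof.
move=> ab vphi; have ba : b != a by rewrite eq_sym.
have tr1 (M : 'M[R[i]]_1) : M 0 0 = M^T 0 0 by rewrite mxE.
have scaled (M M' : 'M[R[i]]_#|{: config L}|) (c : bool) y :
    M^T = M' -> M' *m ket x = c%:R *: ket y ->
    (bra x *m (M *m v)) 0 0 = (c%:R * phi y)%:C.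
  move=> MM' M'x; rewrite rmorphM rmorph_nat /= -vphi [LHS]tr1 [in RHS]tr1.
  by rewrite !trmx_mul !trmxK -mulmxA MM' M'x -scalemxAr [LHS]mxE.
have trspsm : (sp R a *m sm R b)^T = sp R b *m sm R a.
  by rewrite trmx_mul tr_sp tr_sm.
have trsmsp : (sm R a *m sp R b)^T = sm R b *m sp R a.
  by rewrite trmx_mul tr_sp tr_sm.
have trnv : (nhat R a *m vhat R b)^T = vhat R b *m nhat R a.
  by rewrite trmx_mul tr_nhat tr_vhat.
have trvn : (vhat R a *m nhat R b)^T = nhat R b *m vhat R a.
  by rewrite trmx_mul tr_nhat tr_vhat.
rewrite (bond_entry w q r (scaled _ _ _ _ trspsm (spsm_ket x ba))
          (scaled _ _ _ _ trnv (vn_ket b a x))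
          (scaled _ _ _ _ trsmsp (smsp_ket x ba))
          (scaled _ _ _ _ trvn (nv_ket b a x))).
by congr (_%:C); rewrite /bond_action invrK; ring.
Qed.

(** * Particle-number projectors and entries of the shock measure *)

Lemma projN_ket N x : projN R L N *m ket x = (#|x| == N)%:R *: ket x.
Proof.
rewrite /projN mulmx_suml; have [xN|xN] := boolP (#|x| == N).
  rewrite (bigD1 x) //= big1 ?addr0 => [|y /andP[_ yx]].
    by rewrite -mulmxA [bra x *m _]mx11_scalar bra_ket eqxx mulmx1 scale1r.
  rewrite -mulmxA [bra y *m _]mx11_scalar bra_ket (negPf yx).
  by rewrite mul_mx_scalar scale0r.
rewrite scale0r big1 // => y yN.
rewrite -mulmxA [bra y *m _]mx11_scalar bra_ket mul_mx_scalar.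
case: eqP => [yx|_]; last by rewrite scale0r.
by rewrite -yx yN in xN.
Qed.

Lemma tr_projN N : (projN R L N)^T = projN R L N.
Proof.
rewrite /projN linear_sum; apply: eq_bigr => x _ /=.
by rewrite /Defs.bra trmx_mul trmxK.
Qed.

Lemma bra_projN N x : bra x *m projN R L N = (#|x| == N)%:R *: bra x.
Proof. by rewrite -tr_projN /Defs.bra -trmx_mul projN_ket linearZ. Qed.

Lemma bra_diag (D : 'M[R[i]]_#|{: config L}|) (c : config L -> R[i]) x :
  (forall y, D *m ket y = c y *: ket y) -> bra x *m D = c x *: bra x.
Proof.
move=> Dc; apply: matrix_ketP => y; rewrite -mulmxA Dc -scalemxAl -scalemxAr.
rewrite [bra x *m _]mx11_scalar bra_ket.
by case: eqP => [->//|_]; rewrite raddf0 !scaler0.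
Qed.

(* The exponent e(k, l); the two indicators make up sgn(l - k). *)
Definition pair_exponent (k l : 'I_L) : R :=
  2 / L%:R * (k%:R - l%:R) - (l < k)%:R + (k < l)%:R.

Definition site_exponent k y : R := \sum_(l in y) pair_exponent k l.

Lemma sum_nhat_ket (f : 'I_L -> R) (P : pred 'I_L) y :
  \sum_(l | P l) (f l)%:C *: (nhat R l *m ket y)
  = (\sum_(l in y) (P l)%:R * f l)%:C *: ket y.
Proof.
rewrite rmorph_sum scaler_suml big_mkcond [RHS]big_mkcond /=.
apply: eq_bigr => l _; rewrite nhat_ket scalerA.
by case: (P l); case: (l \in y); rewrite ?mulr1 ?mulr0 ?mul1r ?mul0r ?scale0r.
Qed.

Lemma shock_exponent_ket k y :
  shock_exponent R k *m ket y = (site_exponent k y)%:C *: ket y.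
Proof.
rewrite /shock_exponent !mulmxDl mulNmx -scalemxAl !mulmx_suml.
under eq_bigr do rewrite -scalemxAl.
have one (P : pred 'I_L) : \sum_(l | P l) nhat R l *m ket y
    = (\sum_(l in y) (P l)%:R)%:C *: ket y.
  rewrite -(eq_bigr _ (fun l _ => mulr1 _)) -sum_nhat_ket.
  by apply: eq_bigr => l _; rewrite scale1r.
rewrite sum_nhat_ket !one scalerA -scalerBl -scalerDl -!(rmorphM, rmorphB, rmorphD).
congr (_%:C *: _); rewrite /site_exponent mulr_sumr -sumrB -big_split /=.
by apply: eq_bigr => l _; rewrite mul1r.
Qed.

Lemma qpow_ket (q d : R) (D : 'M[R[i]]_#|{: config L}|) y : 0 < q ->
  D *m ket y = d%:C *: ket y -> qpow q D *m ket y = (q `^ d)%:C *: ket y.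
Proof.
move=> q0 Dy; rewrite /powR gt_eqF // mulrC; apply: mexp_eigen.
by rewrite -scalemxAl Dy scalerA rmorphM.
Qed.

(** The component along [y] of the measure with shocks at [x], as read off the operator product;
    [shock_coefE] gives its closed form. *)
Definition shock_coef (q z : R) y x : R :=
  (\prod_(k in x) (z^-1 * q `^ site_exponent k y * (k \in y)%:R)) * z ^+ #|y|.

Lemma shock_prod_ket (q z : R) x y : 0 < q ->
  (\prod_(k in x) ((z^-1)%:C *: (qpow q (shock_exponent R k) *m nhat R k)))
    *m ket y
  = (\prod_(k in x) (z^-1 * q `^ site_exponent k y * (k \in y)%:R))%:C *: ket y.
Proof.
move=> q0; elim/big_rec2: _ => [|k c D kx IH].
  by rewrite rmorph1 scale1r; exact: mul1mx.
rewrite -[(_ * D)%R]/(_ *m D) -mulmxA IH -scalemxAr -scalemxAl -mulmxA nhat_ket.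
rewrite -scalemxAr (qpow_ket q0 (shock_exponent_ket k y)) !scalerA.
by congr (_ *: _); rewrite !rmorphM rmorph_nat /=; ring.
Qed.

Lemma bra_zket (z : R) y : (bra y *m zket L z) 0 0 = (z ^+ #|y|)%:C.
Proof.
rewrite bra_mulE mxE enum_rankK rmorphXn /=.
rewrite (eq_bigr (fun k => if k \in y then z%:C else 1)).
  by rewrite -big_mkcond prodr_const.
by move=> k _; rewrite mxE occ_eq0; case: (k \in y).
Qed.

Lemma bra_shock (q z : R) y x : 0 < q ->
  (bra y *m shock q z x) 0 0 = (shock_coef q z y x)%:C.
Proof.
move=> q0; rewrite /shock mulmxA.
rewrite (bra_diag (c := fun y => (\prod_(k in x)
           (z^-1 * q `^ site_exponent k y * (k \in y)%:R))%:C)).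
  by rewrite -scalemxAl mxE bra_zket -rmorphM.
by move=> y'; exact: shock_prod_ket.
Qed.

Lemma bra_muN (q z : R) N y x : 0 < q ->
  (bra y *m muN q z N x) 0 0 = ((#|y| == N)%:R * shock_coef q z y x)%:C.
Proof.
move=> q0; rewrite /muN mulmxA bra_projN -scalemxAl mxE bra_shock //.
by rewrite [RHS]rmorphM rmorph_nat.
Qed.

End Tensor.

(** * Exponents along the ring and the duality on one bond *)

Section Duality.
Variables (R : realType) (L : nat).
Implicit Types (x y : config L) (k l a b : 'I_L).
Hypothesis L2 : (2 <= L)%N.

Lemma ordS_neq a : a != ordS a.
Proof.
rewrite -val_eqE /=; have aL := ltn_ord a.
by have [aL1|aL1] := eqVneq a.+1 L; [rewrite aL1 modnn|rewrite modn_small]; lia.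
Qed.

(** The linear part contributes [2 / L], and the sign part drops by one at each end of the bond. One
    formula covers the closing bond too, since the exponent is periodic. *)
Lemma pair_exponent_shift a l :
  pair_exponent R (ordS a) l - pair_exponent R a l
  = 2 / L%:R - (l == a)%:R - (l == ordS a)%:R.
Proof.
have L0 : (L%:R : R) != 0 by rewrite pnatr_eq0; lia.
have lL := ltn_ord l; have aL := ltn_ord a; rewrite /pair_exponent -!val_eqE /=.
(* On the closing bond the linear part changes by [2 / L - 2]; the sign part supplies the missing
   2. *)
have [aL1|aL1] := eqVneq a.+1 L.
  have -> : (a.+1 %% L = 0)%N by rewrite aL1 modnn.
  have -> : (l < a)%N = (l != a :> nat) by lia.
  have -> : (a < l)%N = false by lia.
  have -> : (0 < l)%N = (l != 0 :> nat) by lia.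
  have La : (L%:R : R) = a%:R + 1 by rewrite natr1 aL1.
  have -> : (a%:R : R) = L%:R - 1 by rewrite La addrK.
  case: (l == a :> nat); case: (l == 0 :> nat);
    by rewrite /= ?mulr1n ?mulr0n; field.
rewrite modn_small -?natr1; last by lia.
have -> : (l < a.+1)%N = (l < a)%N || (l == a :> nat) by lia.
have -> : (a.+1 < l)%N = (a < l)%N && (l != a.+1 :> nat) by lia.
case: ltngtP => [la|la|la] /=; last 1 first.
- have -> : (l == a.+1 :> nat) = false by lia.
  by rewrite /= ?mulr1n ?mulr0n; field.
- have -> : (l == a.+1 :> nat) = false by lia.
  by rewrite /= ?mulr1n ?mulr0n; field.
by case: (l == a.+1 :> nat); rewrite /= ?mulr1n ?mulr0n; field.
Qed.

Lemma pair_exponentC a b : pair_exponent R a b = - pair_exponent R b a.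
Proof. by rewrite /pair_exponent; ring. Qed.

(** The only nonlocal term is [2 * #|y| / L], exactly what the driving [q ^ (1 - 2 * #|y| / L)]
    compensates; the rest is visible on the bond. *)
Lemma site_exponent_shift a y :
  site_exponent R (ordS a) y - site_exponent R a y
  = 2 * #|y|%:R / L%:R - (a \in y)%:R - (ordS a \in y)%:R.
Proof.
rewrite /site_exponent -sumrB (eq_bigr _ (fun l _ => pair_exponent_shift a l)).
rewrite !sumrB sumr_const.
have mem c : \sum_(l in y) (l == c)%:R = (c \in y)%:R :> R.
  rewrite big_mkcond (bigD1 c) //= eqxx big1 ?addr0 => [|l /negPf->].
    by case: (c \in y).
  by case: ifP.
by rewrite !mem -[_ *+ _]mulr_natr; ring.
Qed.

Definition energy y x : R := \sum_(k in x) site_exponent R k y.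

Lemma energyC y x : energy y x = - energy x y.
Proof.
rewrite /energy /site_exponent exchange_big /= -sumrN; apply: eq_bigr => l _.
by rewrite -sumrN; apply: eq_bigr => k _; rewrite pair_exponentC.
Qed.

(** Both sums are compared with the sum over [b |: x], which contains both sites. *)
Lemma sum_hop (f : 'I_L -> R) x a b : a \in x -> b \notin x ->
  \sum_(k in hop x a b) f k = \sum_(k in x) f k + (f b - f a).
Proof.
move=> ax bx.
have : \sum_(k in b |: x) f k = f a + \sum_(k in hop x a b) f k.
  by apply: big_setD1; rewrite !inE ax orbT.
by rewrite big_setU1 //= => E; apply: (addrI (f a)); rewrite -E; ring.
Qed.

Lemma energy_hop_right y x a b : a \in x -> b \notin x ->
  energy y (hop x a b) = energy y x + (site_exponent R b y - site_exponent R a y).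
Proof. exact: sum_hop. Qed.

Lemma energy_hop_left y x a b : a \in y -> b \notin y ->
  energy (hop y a b) x = energy y x - (site_exponent R b x - site_exponent R a x).
Proof.
(* Antisymmetry turns a hop in the first argument into a hop in the second. *)
by move=> ay byy; rewrite energyC energy_hop_right // [energy y x]energyC; ring.
Qed.

Lemma card_hop x a b : a \in x -> b \notin x -> #|hop x a b| = #|x|.
Proof.
move=> ax bx; have := cardsD1 a (b |: x).
by rewrite !inE ax orbT cardsU1 bx => /eqP; rewrite eqn_add2l => /eqP.
Qed.

Lemma shock_coefE (q z : R) y x : 0 < q ->
  shock_coef q z y x
  = z ^+ #|y| * z^-1 ^+ #|x| * (x \subset y)%:R * q `^ energy y x.
Proof.
move=> q0; rewrite /shock_coef !big_split /= prodr_const.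
have -> : \prod_(k in x) q `^ site_exponent R k y = q `^ energy y x.
  apply/esym; apply: (big_morph (fun r => q `^ r)) => [r s|]; last exact: powRr0.
  by rewrite powRD // (gt_eqF q0) implybT.
have -> : \prod_(k in x) (k \in y)%:R = (x \subset y)%:R :> R.
  have [xy|/subsetPn[k kx ky]] := boolP (x \subset y).
    by rewrite big1 // => k kx; rewrite (fintype.subsetP xy).
  by rewrite (bigD1 k) //= (negPf ky) mul0r.
by ring.
Qed.

(** The part of the inclusion that no hop across the bond can change; what remains depends on four
    occupation bits. *)
Definition subset_off a b x y : bool :=
  [forall k, (k != a) && (k != b) && (k \in x) ==> (k \in y)].

Lemma subset_split a b x y :
  (x \subset y) = [&& subset_off a b x y, (a \in x) ==> (a \in y)
                    & (b \in x) ==> (b \in y)].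
Proof.
apply/fintype.subsetP/and3P => [xy|[/forallP xy /implyP axy /implyP bxy] k kx].
  split; try (apply/implyP; exact: xy).
  by apply/forallP => k; apply/implyP => /andP[_ /xy].
have [ka|ka] := eqVneq k a; first by rewrite ka axy -?ka.
have [kb|kb] := eqVneq k b; first by rewrite kb bxy -?kb.
by have /implyP := xy k; apply; rewrite ka kb.
Qed.

Lemma subset_off_hop a b x y :
  ((subset_off a b (hop x a b) y = subset_off a b x y)
  * (subset_off a b (hop x b a) y = subset_off a b x y)
  * (subset_off a b x (hop y a b) = subset_off a b x y)
  * (subset_off a b x (hop y b a) = subset_off a b x y))%type.
Proof.
by do ![split]; apply: eq_forallb => k; rewrite !inE;
  case: (k == a); case: (k == b).
Qed.

Lemma powR_occ (q : R) (c c' : bool) : 0 < q ->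
  q `^ (1 - c%:R - c'%:R) = if c then (if c' then q^-1 else 1)
                            else (if c' then 1 else q).
Proof.
move=> q0; case: c; case: c'; rewrite ?mulr1n ?mulr0n ?subr0 ?subrr ?powRr0 //.
  by rewrite sub0r powR_inv1 // ltW.
by rewrite powRr1 // ltW.
Qed.

(* The first term involves the inverse of alpha because the bond operator acts
   there on bras, i.e. through its transpose. *)
Lemma bond_duality (q w z : R) x y a :
  0 < q -> let b := ordS a in
  bond_action w q (q `^ (1 - 2 * #|x|%:R / L%:R))^-1
    (fun y => shock_coef q z y x) a b y
  - bond_action w q (q `^ (1 - 2 * #|y|%:R / L%:R))
    (fun x => shock_coef q z y x) a b x
  = - w * (q - q^-1) * shock_coef q z y x
    * (((b \in y)%:R - (b \in x)%:R) - ((a \in y)%:R - (a \in x)%:R)).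
Proof.
move=> q0 b; have ab : a != b by exact: ordS_neq.
have ba : b != a by rewrite eq_sym.
have Q r s : q `^ (r + s) = q `^ r * q `^ s.
  by rewrite powRD // (gt_eqF q0) implybT.
(* Here [r] is the nonlocal [2 * #|x| / L] or [2 * #|y| / L]: driving and energy change of a hop
   cancel it, leaving only occupations [c], [d] on the bond. *)
have powN E r c d : (q `^ (1 - r))^-1 * q `^ (E - (r - c - d))
    = q `^ E * (q `^ (1 - c - d))^-1.
  by rewrite -!powRN -!Q; congr (_ `^ _); ring.
have powP E r c d : q `^ (1 - r) * q `^ (E + (r - c - d))
    = q `^ E * q `^ (1 - c - d).
  by rewrite -!Q; congr (_ `^ _); ring.
(* [P] is the factor common to all coefficients involved; [ok] is the inclusion condition at the two
   sites of the bond. *)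
pose P := z ^+ #|y| * z^-1 ^+ #|x| * (subset_off a b x y)%:R * q `^ energy y x.
pose ok (xa ya xb yb : bool) : R := ((xa ==> ya) && (xb ==> yb))%:R.
have okE x' y' : (x' \subset y')%:R = (subset_off a b x' y')%:R
    * ok (a \in x') (a \in y') (b \in x') (b \in y') :> R.
  by rewrite (subset_split a b) -natrM mulnb.
have coefE : shock_coef q z y x = P * ok (a \in x) (a \in y) (b \in x) (b \in y).
  by rewrite shock_coefE // okE /P; ring.
have mem_hop c d (u : config L) : c != d ->
    ((c \in hop u c d) = false) * ((d \in hop u c d) = true).
  by move=> cd; rewrite !inE !eqxx [d == c]eq_sym (negPf cd).
pose X := q `^ (1 - (a \in x)%:R - (b \in x)%:R).
pose Y := q `^ (1 - (a \in y)%:R - (b \in y)%:R).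
have T1 : a \in y -> b \notin y ->
    (q `^ (1 - 2 * #|x|%:R / L%:R))^-1 * shock_coef q z (hop y a b) x
    = P * ok (a \in x) false (b \in x) true * X^-1.
  move=> ay yb; rewrite shock_coefE // card_hop // energy_hop_left //.
  rewrite site_exponent_shift.
  rewrite okE subset_off_hop !mem_hop // /P /X.
  by rewrite mulrCA powN; ring.
have T2 : b \in y -> a \notin y ->
    q `^ (1 - 2 * #|x|%:R / L%:R) * shock_coef q z (hop y b a) x
    = P * ok (a \in x) true (b \in x) false * X.
  move=> yb ay; rewrite shock_coefE // card_hop // energy_hop_left //.
  rewrite -[site_exponent R a x - _]opprB site_exponent_shift opprK.
  rewrite okE subset_off_hop !mem_hop // /P /X.
  by rewrite mulrCA powP; ring.
have T3 : a \in x -> b \notin x ->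
    q `^ (1 - 2 * #|y|%:R / L%:R) * shock_coef q z y (hop x a b)
    = P * ok false (a \in y) true (b \in y) * Y.
  move=> ax xb; rewrite shock_coefE // card_hop // energy_hop_right //.
  rewrite site_exponent_shift.
  rewrite okE subset_off_hop !mem_hop // /P /Y.
  by rewrite mulrCA powP; ring.
have T4 : b \in x -> a \notin x ->
    (q `^ (1 - 2 * #|y|%:R / L%:R))^-1 * shock_coef q z y (hop x b a)
    = P * ok true (a \in y) false (b \in y) * Y^-1.
  move=> xb ax; rewrite shock_coefE // card_hop // energy_hop_right //.
  rewrite -[site_exponent R a y - _]opprB site_exponent_shift.
  rewrite okE subset_off_hop !mem_hop // /P /Y.
  by rewrite mulrCA powN; ring.
rewrite /bond_action invrK coefE.
(* [T1] to [T4] hold only for allowed hops; elsewhere the indicator in [bond_action] vanishes, so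
   they may be rewritten under it. *)
have guard (c d : bool) (s s' t : R) : (c -> ~~ d -> s = s') ->
    (c && ~~ d)%:R * (s - t) = (c && ~~ d)%:R * (s' - t).
  by case: c; case: d => //= H; rewrite ?mul0r // H.
rewrite (guard _ _ _ _ _ T1) (guard _ _ _ _ _ T2).
rewrite (guard _ _ _ _ _ T3) (guard _ _ _ _ _ T4) /X /Y !powR_occ // /ok.
(* Sixteen occupation patterns remain, each an identity between multiples of [P]. *)
case: (a \in x); case: (a \in y); case: (b \in x); case: (b \in y);
  rewrite /= ?invrK ?invr1 ?mulr1n ?mulr0n; ring.
Qed.

(** Hops conserve the particle number; this serves to remove the indicators left by the
    projectors. *)
Lemma bond_action_eq (w q r : R) (phi psi : config L -> R) a b x :
  (forall y, #|y| = #|x| -> phi y = psi y) ->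
  bond_action w q r phi a b x = bond_action w q r psi a b x.
Proof.
move=> E; rewrite /bond_action !(E x) //.
by case: (boolP (a \in x)) => ax; case: (boolP (b \in x)) => bx;
   rewrite /= ?mul0r // !E // card_hop.
Qed.

(** * The whole ring and its restriction to fixed particle numbers *)

Lemma HgenE (w q r : R) : Hgen L w q r 1 = \sum_k bond w q r k (ordS k).
Proof.
rewrite /Hgen mulr1 [RHS](bigID (fun k : 'I_L => k.+1 < L)%N) /=; congr (_ + _).
by apply: eq_bigl => k; have := ltn_ord k; lia.
Qed.

Lemma Hgen_duality (q w z : R) x y : 0 < q ->
  \sum_k bond_action w q (q `^ (1 - 2 * #|x|%:R / L%:R))^-1
    (fun y => shock_coef q z y x) k (ordS k) y
  = \sum_k bond_action w q (q `^ (1 - 2 * #|y|%:R / L%:R))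
    (fun x => shock_coef q z y x) k (ordS k) x.
Proof.
move=> q0; apply/eqP; rewrite -subr_eq0 -sumrB.
pose g k : R := (k \in y)%:R - (k \in x)%:R.
(* [ordS] permutes the sites, so the defects of [bond_duality] telescope. *)
have shift : \sum_k g (ordS k) = \sum_k g k.
  by rewrite [RHS](reindex_inj (@ordS_inj L)).
rewrite (eq_bigr (fun k => - w * (q - q^-1) * shock_coef q z y x
                           * (g (ordS k) - g k))); last first.
  by move=> k _; exact: bond_duality.
by rewrite -mulr_sumr sumrB shift subrr mulr0.
Qed.

Lemma matrix_bra_ketP (A B : 'M[R[i]]_#|{: config L}|) :
  (forall x y, (bra R y *m A *m ket R x) 0 0 = (bra R y *m B *m ket R x) 0 0) ->
  A = B.
Proof.
move=> AB; apply: matrix_ketP => x; apply: matrix_braP => y.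
by rewrite !mulmxA [LHS]mx11_scalar [RHS]mx11_scalar AB.
Qed.

Lemma Hgen_entry (w q r : R) (u : 'rV[R[i]]_#|{: config L}|)
    (v : 'cV[R[i]]_#|{: config L}|) :
  (u *m Hgen L w q r 1 *m v) 0 0
  = \sum_k (u *m bond w q r k (ordS k) *m v) 0 0.
Proof. by rewrite HgenE mulmx_sumr mulmx_suml summxE. Qed.

Lemma sum_muN_ket (q z : R) (N K : nat) x :
  (\sum_(y : config L | #|y| == K) muN q z N y *m bra R y) *m ket R x
  = (#|x| == K)%:R *: muN q z N x.
Proof.
have term y : muN q z N y *m bra R y *m ket R x = (y == x)%:R *: muN q z N y.
  by rewrite -mulmxA [bra R y *m _]mx11_scalar bra_ket mul_mx_scalar.
rewrite mulmx_suml (eq_bigr _ (fun y _ => term y)).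
rewrite big_mkcond (bigD1 x) //= eqxx big1 ?addr0 => [|y /negPf->].
  by case: (_ == K); rewrite ?scale1r ?scale0r.
by case: ifP; rewrite ?scale0r.
Qed.

Lemma projN_idem (N : nat) : projN R L N *m projN R L N = projN R L N.
Proof.
apply: matrix_ketP => x; rewrite -mulmxA projN_ket -scalemxAr projN_ket.
by case: (_ == N); rewrite ?scale0r ?scale1r.
Qed.

Lemma projN_muN (q z : R) (N : nat) x :
  projN R L N *m muN q z N x = muN q z N x.
Proof. by rewrite /muN mulmxA projN_idem. Qed.

Lemma bra_projN_mul (H : 'M[R[i]]_#|{: config L}|) (q z : R) (N : nat) y x :
  bra R y *m (projN R L N *m H *m projN R L N *m muN q z N x)
  = (#|y| == N)%:R *: (bra R y *m H *m muN q z N x).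
Proof. by rewrite -!mulmxA projN_muN mulmxA bra_projN -scalemxAl. Qed.

Lemma mul_projN_ket (H : 'M[R[i]]_#|{: config L}|)
    (u : 'rV[R[i]]_#|{: config L}|) (K : nat) x :
  u *m (projN R L K *m H *m projN R L K) *m ket R x
  = (#|x| == K)%:R *: (u *m projN R L K *m H *m ket R x).
Proof. by rewrite -!mulmxA projN_ket -!scalemxAr. Qed.

(** Both sides are compared between [bra y] and [ket x]. They vanish unless [x] has [K] and [y] has
    [N] particles; in that sector the projectors drop out and [Hgen_duality] applies. *)
Lemma HNK_duality (q w z : R) (K N : nat) : 0 < q ->
  let M := \sum_(y : config L | #|y| == K) muN q z N y *m bra R y in
  HNK L w q N K *m M = M *m HNK L w q K N.
Proof.
move=> q0 M; apply: matrix_bra_ketP => x y.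
have scale_entry (c : R[i]) (A : 'M[R[i]]_1) : (c *: A) 0 0 = c * A 0 0.
  by rewrite mxE.
have Mx x' : (bra R y *m (M *m ket R x')) 0 0
    = ((#|x'| == K)%:R * ((#|y| == N)%:R * shock_coef q z y x'))%:C.
  by rewrite sum_muN_ket -scalemxAr scale_entry bra_muN // [RHS]rmorphM rmorph_nat.
have -> : bra R y *m (HNK L w q N K *m M) *m ket R x
    = ((#|y| == N)%:R * (#|x| == K)%:R)
      *: (bra R y *m Hgen L w q (q `^ (1 - 2 * K%:R / L%:R)) 1 *m muN q z N x).
  rewrite -mulmxA -[X in _ *m X]mulmxA sum_muN_ket -!scalemxAr bra_projN_mul.
  by rewrite scalerA mulrC.
have -> : bra R y *m (M *m HNK L w q K N) *m ket R x
    = (#|x| == K)%:R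
      *: (bra R y *m M *m projN R L K *m Hgen L w q (q `^ (1 - 2 * N%:R / L%:R)) 1
          *m ket R x).
  by rewrite mulmxA mul_projN_ket.
rewrite !scale_entry.
have [xK|xK] := eqVneq #|x| K; last by rewrite mulr0 !mul0r.
rewrite mulr1 mul1r !Hgen_entry.
rewrite (eq_bigr _ (fun k _ =>
  bra_bond_entry w q _ y (ordS_neq k) (fun y' => bra_muN z N y' x q0))).
have right x' : (bra R y *m M *m projN R L K *m ket R x') 0 0
    = ((#|x'| == K)%:R * ((#|y| == N)%:R * shock_coef q z y x'))%:C.
  rewrite -!mulmxA projN_ket -!scalemxAr scale_entry Mx.
  by case: (_ == K); rewrite !(mul1r, mul0r).
rewrite (eq_bigr _ (fun k _ => bond_ket_entry w q _ x (ordS_neq k) right)).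
have [yN|yN] := eqVneq #|y| N; last first.
  rewrite mul0r big1 // => k _; rewrite /bond_action.
  by rewrite !(mul0r, mulr0, subrr, addr0).
rewrite mul1r -!rmorph_sum; congr (_%:C).
have coefN y' : #|y'| = #|y| ->
    (#|y'| == N)%:R * shock_coef q z y' x = shock_coef q z y' x.
  by rewrite yN => ->; rewrite eqxx mul1r.
have coefK x' : #|x'| = #|x| ->
    (#|x'| == K)%:R * (true%:R * shock_coef q z y x') = shock_coef q z y x'.
  by rewrite xK => ->; rewrite eqxx !mul1r.
rewrite (eq_bigr _ (fun k _ => bond_action_eq w q _ k (ordS k) coefN)).
rewrite [RHS](eq_bigr _ (fun k _ => bond_action_eq w q _ k (ordS k) coefK)).
by rewrite -xK -yN; exact: Hgen_duality.
Qed.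

End Duality.

(** * Time evolution of the shock measure *)

Lemma mulmx_outer (F : comPzRingType) (n m : nat) (v : 'cV[F]_n) (u : 'rV[F]_m)
    (A : 'M[F]_m) (k : 'cV[F]_m) :
  v *m u *m A *m k = (u *m A *m k) 0 0 *: v.
Proof. by rewrite -2!mulmxA [X in _ *m X]mx11_scalar mul_mx_scalar !mulmxA. Qed.

Theorem theorem2 (R : realType) (L : nat) (hL : (2 <= L)%N)
    (q w z : R) (hq : 0 < q) (hq1 : q != 1) (hw : w != 0) (hz : 0 < z)
    (K : nat) (x : {set 'I_L}) (hK : #|x| = K)
    (N : nat) (hN : (N <= L)%N) (t : R) (ht : 0 <= t) :
  muN_at w q z N x t =
  \sum_(y : {set 'I_L} | #|y| == K) trans_prob w q N K y x t *: muN q z N y.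
Proof.
have dual := @HNK_duality R L hL q w z K N hq.
set M := \sum_(y | _) _ in dual.
have dualt : - (t%:C *: HNK L w q N K) *m M = M *m - (t%:C *: HNK L w q K N).
  by rewrite mulNmx mulmxN -scalemxAl dual scalemxAr.
(* The initial measure is column [x] of [M], so its exponential evolution can be moved past [M]; the
   rank-one terms of [M] then produce the transition probabilities. *)
have muM : muN q z N x = M *m ket R x.
  by rewrite sum_muN_ket hK eqxx scale1r.
rewrite /muN_at hK muM mulmxA (mexp_intertwine dualt) /M !mulmx_suml.
by apply: eq_bigr => y _; exact: mulmx_outer.
Qed.
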